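(* Let $z\in(0,1]$ and let $\nu\in\mathbb{R}$ satisfy $z^2\le\nu\le1$, and consider the scheme defined by $A(z)=I-z\,D_0+\frac{\nu}{2}\,\Delta$ together with the second order extrapolation condition $\Delta\Phi_0=0$ (which defines the ghost value $\Phi_1$). Then, for every $h_0>0$, the boundary contribution $E:=(1-h_0)\,T_{-1}+h_0\,T_0+h_0\,S_0$ is given by $$E=\begin{pmatrix}\Phi_0\\ D\Phi_0\end{pmatrix}^T B\begin{pmatrix}\Phi_0\\ D\Phi_0\end{pmatrix},\qquad B=\begin{pmatrix}-z& z\left(\frac12-h_0\right)+\frac{\nu}{2}\\ z\left(\frac12-h_0\right)+\frac{\nu}{2}& h_0z^2-\frac{\nu(1+z)}{2}\end{pmatrix}.$$ Moreover, $B$ is negative definite (and thus the scheme is semi-bounded with respect to $(\cdot,\cdot)_H$) for the choice $h_0=\frac12\left(1-z+\frac{\nu}{z}\right)$.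
   Context: Difference operators: $D\Phi_j:=\Phi_j-\Phi_{j-1}$, $D_0\Phi_j:=\frac12(\Phi_{j+1}-\Phi_{j-1})$, $\Delta\Phi_j:=\Phi_{j-1}-2\Phi_j+\Phi_{j+1}$; $I$ is the identity. Sequences are real valued. Inner product: for $h_0>0$, $(\boldsymbol{\Phi},\boldsymbol{\Psi})_H:=\sum_{j\le -1}\Phi_j\Psi_j+h_0\Phi_0\Psi_0$ for sequences indexed by $j\le 0$. Set $$T_j:=\begin{pmatrix}\Phi_j\\ D\Phi_{j+1}\end{pmatrix}^T\begin{pmatrix}-z&\frac{\nu-z}{2}\\ \frac{\nu-z}{2}&\frac{\nu(1-z)}{2}\end{pmatrix}\begin{pmatrix}\Phi_j\\ D\Phi_{j+1}\end{pmatrix},$$ $$S_j:=-\frac{\nu-z^2}{2}\left[(D\Phi_j)^2+(D\Phi_{j+1})^2\right]+\frac{\nu^2-z^2}{4}\,(D\Phi_{j+1}-D\Phi_j)^2 .$$ Semi-boundedness: together with extrapolation conditions defining the ghost value $\Phi_1$ from $(\Phi_j)_{j\le 0}$, $A(z)$ is called semi-bounded with respect to $(\cdot,\cdot)_H$ if, for the given $z\ge0$: (1) the scheme is contractive, i.e. for every real sequence $(\Phi_j)_{j\in\mathbb{Z}}$, with $\Psi_j=A(z)\Phi_j$, one has $\Psi_j^2=\Phi_j^2+T_j-T_{j-1}+S_j$ and $S_j\le0$ for all $j$; and (2) for every sequence $(\Phi_j)_{j\le0}$ extended by the extrapolation condition, $E:=(1-h_0)\,T_{-1}+h_0\,T_0+h_0\,S_0\le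 0$. *)

(* Defs.v *)
From mathcomp Require Import all_boot all_order all_algebra.
From mathcomp Require Import reals.

Set Implicit Arguments.
Unset Strict Implicit.
Unset Printing Implicit Defensive.

Import Order.TTheory GRing.Theory Num.Theory.
Local Open Scope ring_scope.

(* Grid functions are indexed by all of int.  A sequence given for j <= 0
   together with its ghost value at j = 1 is the restriction of such a
   function; entries at j >= 2 are never read by the boundary quantities. *)

Section DifferenceOperators.
Variables (R : realType) (Phi : int -> R).

Definition D (j : int) : R := Phi j - Phi (j - 1).
Definition D0 (j : int) : R := (Phi (j + 1) - Phi (j - 1)) / 2.
Definition Delta (j : int) : R := Phi (j - 1) - 2 * Phi j + Phi (j + 1).

End DifferenceOperators.

Section SmallMatrices.
Variable R : realType.

Definition vec2 (x y : R) : 'cV[R]_2 := \col_i (if i == 0 then x else y).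

(* Rows (a, b) and (c, d). *)
Definition mx2 (a b c d : R) : 'M[R]_2 :=
  \matrix_(i, j) (if i == 0 then (if j == 0 then a else b)
                  else (if j == 0 then c else d)).

Definition qform n (M : 'M[R]_n) (v : 'cV[R]_n) : R := (v^T *m M *m v) 0 0.

Definition negative_definite n (M : 'M[R]_n) : Prop :=
  M^T = M /\ forall v : 'cV[R]_n, v != 0 -> qform M v < 0.

End SmallMatrices.

Section Scheme.
Variables (R : realType) (nu z : R).
Implicit Type Phi : int -> R.

Definition scheme Phi : int -> R :=
  fun j => Phi j - z * D0 Phi j + nu / 2 * Delta Phi j.

Definition T_ Phi (j : int) : R :=
  qform (mx2 (- z)           ((nu - z) / 2)
             ((nu - z) / 2)  (nu * (1 - z) / 2))
        (vec2 (Phi j) (D Phi (j + 1))).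

Definition S_ Phi (j : int) : R :=
  - ((nu - z ^+ 2) / 2) * (D Phi j ^+ 2 + D Phi (j + 1) ^+ 2)
  + (nu ^+ 2 - z ^+ 2) / 4 * (D Phi (j + 1) - D Phi j) ^+ 2.

Definition E (h0 : R) Phi : R :=
  (1 - h0) * T_ Phi (-1) + h0 * T_ Phi 0 + h0 * S_ Phi 0.

Definition B (h0 : R) : 'M[R]_2 :=
  mx2 (- z)                          (z * (1 / 2 - h0) + nu / 2)
      (z * (1 / 2 - h0) + nu / 2)    (h0 * z ^+ 2 - nu * (1 + z) / 2).

Definition contractive (A : (int -> R) -> int -> R) : Prop :=
  forall Phi (j : int),
    (A Phi j) ^+ 2 = Phi j ^+ 2 + T_ Phi j - T_ Phi (j - 1) + S_ Phi j
    /\ S_ Phi j <= 0.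

(* The values at j <= 0 determine exactly one value at j = 1 for which the
   condition holds, irrespective of the entries at j >= 2. *)
Definition defines_ghost (extrap : (int -> R) -> Prop) : Prop :=
  forall Phi, exists g : R, forall Psi : int -> R,
    (forall j : int, j <= 0 -> Psi j = Phi j) ->
    (extrap Psi <-> Psi 1 = g).

(* The inner product (Phi, Psi)_H = sum_(j <= -1) Phi_j Psi_j + h0 Phi_0 Psi_0
   enters the definition only through its weight h0 > 0. *)
Definition semi_bounded (A : (int -> R) -> int -> R)
    (extrap : (int -> R) -> Prop) (h0 : R) : Prop :=
  [/\ 0 < h0,
      defines_ghost extrap,
      contractive A
    & forall Phi, extrap Phi -> E h0 Phi <= 0].

End Scheme.

Definition second_order_extrap (R : realType) (Phi : int -> R) : Prop :=
  Delta Phi 0 = 0.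

(* Main.v *)
Require Import Defs.
From mathcomp Require Import all_boot all_order all_algebra.
From mathcomp Require Import reals.
From mathcomp Require Import ring lra.
Import Order.TTheory GRing.Theory Num.Theory.
Local Open Scope ring_scope.

(** The extrapolation condition says that [Phi] is affine across the boundary,
    [D Phi 1 = D Phi 0], so [T_(-1)], [T_0] and [S_0] are all quadratic forms in
    [p = Phi 0] and [d = D Phi 0] alone, and [E] is read off from
    [Phi (-1) = p - d] ([boundary_form]).

    The determinant of [B] is a concave quadratic polynomial in [h0], maximal
    where the off-diagonal entry equals [z^2 / 2]: this is the weight
    [h0 = (1 - z + nu / z) / 2].  The lower diagonal entry is then
    [(z^2 - z^3 - nu) / 2], and completing the square turns the form into
      [- z (p - z d / 2)^2 - (z^3 / 4 + (nu - z^2) / 2) d^2],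
    negative definite as soon as [nu >= z^2] ([B_negative_definite]).

    In the interior, the energy balance is a polynomial identity.  Its
    dissipation [S_j] is nonpositive because [nu^2 <= nu] on [0, 1], which leaves
    at most [- (nu - z^2) / 4 * (D Phi_j + D Phi_(j+1))^2]
    ([scheme_contractive]). *)

Section QuadraticForms.
Variable R : realType.

Lemma qform_mx2 (a b c d x y : R) :
  qform (mx2 a b c d) (vec2 x y) = a * x ^+ 2 + (b + c) * (x * y) + d * y ^+ 2.
Proof.
rewrite /qform !mxE !big_ord_recl !big_ord0 !mxE.
by rewrite !big_ord_recl !big_ord0 !mxE /=; ring.
Qed.

Lemma vec2_eta (v : 'cV[R]_2) : v = vec2 (v 0 0) (v 1 0).
Proof.
apply/matrixP => i j; rewrite mxE ord1.
by case: i => [[|[|i]] lt_i2] //=; congr (v _ _); exact: val_inj.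
Qed.

Lemma tr_mx2 (a b c d : R) : (mx2 a b c d)^T = mx2 a c b d.
Proof. by apply/matrixP => i j; rewrite !mxE; do 2 case: eqP. Qed.

Lemma vec2_eq0 (x y : R) : (vec2 x y == 0) = (x == 0) && (y == 0).
Proof.
apply/eqP/andP => [/matrixP e | [/eqP -> /eqP ->]].
  by move: (e 0 0) (e 1 0); rewrite !mxE /= => -> ->.
by apply/matrixP => i j; rewrite !mxE if_same.
Qed.

Lemma negative_definite_le0 n (M : 'M[R]_n) (v : 'cV[R]_n) :
  negative_definite M -> qform M v <= 0.
Proof.
case=> _ Mneg; have [->|/Mneg/ltW//] := eqVneq v 0.
by rewrite /qform mulmx0 mxE.
Qed.

End QuadraticForms.

Section Scheme.
Variables (R : realType) (z nu : R).
Implicit Types (Phi : int -> R) (j : int).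

Lemma T_E Phi j : T_ nu z Phi j =
  - z * Phi j ^+ 2 + (nu - z) * (Phi j * D Phi (j + 1))
  + nu * (1 - z) / 2 * D Phi (j + 1) ^+ 2.
Proof. by rewrite /T_ qform_mx2; field. Qed.

(** All terms are quadratic polynomials in three consecutive values of [Phi]. *)
Lemma energy_balance Phi j :
  scheme nu z Phi j ^+ 2
  = Phi j ^+ 2 + T_ nu z Phi j - T_ nu z Phi (j - 1) + S_ nu z Phi j.
Proof.
by rewrite !T_E /scheme /S_ /D0 /Delta /D addrK subrK; field.
Qed.

Lemma S_le0 Phi j : z ^+ 2 <= nu <= 1 -> S_ nu z Phi j <= 0.
Proof.
move=> /andP[znu nu1]; rewrite /S_.
move: (D Phi j) (D Phi (j + 1)) => a b.
have nu0 : 0 <= nu by apply: le_trans znu; exact: sqr_ge0.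
(* As [nu^2 <= nu], the coefficient of [(b - a)^2] is at most [(nu - z^2) / 4];
   what is left is [(nu - z^2) / 4] times
   [(b - a)^2 - 2 (a^2 + b^2) = - (a + b)^2]. *)
have h1 : 0 <= nu * (1 - nu) * (b - a) ^+ 2.
  by apply: mulr_ge0 (sqr_ge0 _); rewrite mulr_ge0 ?subr_ge0.
have h2 : 0 <= (nu - z ^+ 2) * (a + b) ^+ 2.
  by apply: mulr_ge0 (sqr_ge0 _); rewrite subr_ge0.
suff -> : - ((nu - z ^+ 2) / 2) * (a ^+ 2 + b ^+ 2)
          + (nu ^+ 2 - z ^+ 2) / 4 * (b - a) ^+ 2
        = - (nu * (1 - nu) * (b - a) ^+ 2 + (nu - z ^+ 2) * (a + b) ^+ 2) / 4.
  by lra.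
by field.
Qed.

Lemma scheme_contractive :
  z ^+ 2 <= nu <= 1 -> contractive nu z (scheme nu z).
Proof. by move=> hnu Phi j; split; [exact: energy_balance | exact: S_le0]. Qed.

Lemma second_order_extrapE Phi :
  second_order_extrap Phi <-> Phi 1 = 2 * Phi 0 - Phi (-1).
Proof. by rewrite /second_order_extrap /Delta sub0r add0r; split; lra. Qed.

Lemma second_order_defines_ghost : defines_ghost (@second_order_extrap R).
Proof.
move=> Phi; exists (2 * Phi 0 - Phi (-1)) => Psi eqPsi.
by rewrite -!eqPsi //; exact: second_order_extrapE.
Qed.

Lemma boundary_form h0 Phi : second_order_extrap Phi ->
  E nu z h0 Phi = qform (B nu z h0) (vec2 (Phi 0) (D Phi 0)).
Proof.
move=> /second_order_extrapE Phi1.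
rewrite /E !T_E qform_mx2 /S_ /D !addNr !add0r subrr Phi1.
by field.
Qed.

(** Since [nu / z >= z], this weight is in fact at least [1 / 2]. *)
Lemma weight_gt0 : 0 < z -> z ^+ 2 <= nu -> 0 < 1 / 2 * (1 - z + nu / z).
Proof.
move=> z0; rewrite expr2 -ler_pdivlMr // => h.
by lra.
Qed.

Lemma B_negative_definite : 0 < z -> z ^+ 2 <= nu ->
  negative_definite (B nu z (1 / 2 * (1 - z + nu / z))).
Proof.
move=> z0 znu; split; first by rewrite tr_mx2.
move=> v; rewrite (vec2_eta _ v) vec2_eq0 qform_mx2.
move: (v 0 0) (v 1 0) => p d pd0.
rewrite [X in X < 0](_ : _ = - (z * (p - z * d / 2) ^+ 2
    + (z ^+ 3 / 4 + (nu - z ^+ 2) / 2) * d ^+ 2)); last first.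
  by field; rewrite gt_eqF.
have c0 : 0 < z ^+ 3 / 4 + (nu - z ^+ 2) / 2.
  by have := exprn_gt0 3 z0; lra.
rewrite oppr_lt0; have [d0|d0] := eqVneq d 0.
  move: pd0; rewrite d0 eqxx andbT => p0.
  by rewrite expr0n /= !(mulr0, mul0r) subr0 addr0 mulr_gt0 // exprn_even_gt0.
apply: ltr_wpDl; first by rewrite mulr_ge0 ?sqr_ge0 ?ltW.
by rewrite mulr_gt0 // exprn_even_gt0.
Qed.

End Scheme.

Theorem corollary2 (R : realType) (z nu : R)
    (hz : 0 < z <= 1) (hnu : z ^+ 2 <= nu <= 1) :
  (forall h0 : R, 0 < h0 ->
     forall Phi : int -> R, second_order_extrap Phi ->
       E nu z h0 Phi = qform (B nu z h0) (vec2 (Phi 0) (D Phi 0)))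
  /\
  (let h0 : R := 1 / 2 * (1 - z + nu / z) in
   negative_definite (B nu z h0)
   /\ semi_bounded nu z (scheme nu z) (@second_order_extrap R) h0).
Proof.
have [/andP[z0 _] /andP[znu _]] := (hz, hnu).
split=> [h0 _ Phi | h0]; first exact: boundary_form.
have Bneg : negative_definite (B nu z h0) by exact: B_negative_definite.
split=> //; split.
- exact: weight_gt0.
- exact: second_order_defines_ghost.
- exact: scheme_contractive.
- by move=> Phi /boundary_form ->; exact: negative_definite_le0.
Qed.
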